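(* Let $k \geq 2$, $0 \leq j \leq k-1$, and $n = a(k+1) + r \geq 0$ with integers $a$ and $r$, $-1 \leq r \leq k-1$. (i) If $r=-1$ or $r=j$, then $v_2(B_n(k,j)) = 0$. (ii) If $0 \leq r \leq j-1$, $a \geq 2$, $\Delta_1 > 0$ and $\Delta_2 > 0$, then $$v_2(B_n(k,j)) = r+1+ v_2 \left( \binom{a + r}{a-1} \right).$$ (iii) If $j+1 \leq r \leq k-1$, $a \geq 1$, $\Delta_3 >0$ and $\Delta_4 >0$, then $$v_2(B_n(k,j)) = r-j+ v_2 \left( \binom{a+ r-j-1}{a-1} \right).$$
   Context: For integers $k \geq 2$ and $0 \leq j \leq k-1$, the sequence $\{B_n(k,j)\}_{n\geq 0}$ is defined by the recurrence $B_n(k,j) = B_{n-1}(k,j) + B_{n-2}(k,j)+\dots+B_{n-k}(k,j)$ for all $n \geq k$, with initial values $B_j(k,j)=1$ and $B_i(k,j)=0$ for $0 \leq i \leq k-1$, $i \neq j$. $v_2$ denotes the 2-adic order (2-adic valuation), with $v_2(0)=+\infty$. With $n = a(k+1)+r$, $-1 \leq r \leq k-1$, define: if $-1 \leq r \leq j-1$ and $a \geq 2$, $$\Delta_1 = (r+k+2) - v_2 \left( \binom{a+r}{a-1} 2^{r+1} \right),$$ $$\Delta_2 = v_2 \left( \binom{a + r+k-j-1}{a-2} 2^{r+k+1-j} \right) - v_2 \left( \binom{a+r}{a-1} 2^{r+1} \right);$$ if $j \leq r \leq k-1$ (and $a \geq 1$), $$\Delta_3 = (r+k+1-j)- v_2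 \left( \binom{a+ r-j-1}{a-1} 2^{r-j} \right),$$ $$\Delta_4 = v_2 \left( \binom{a+ r}{a-1} 2^{r+1} \right) - v_2 \left( \binom{a+ r-j-1}{a-1} 2^{r-j} \right).$$ *)

(* Defs.v *)
From mathcomp Require Import all_boot all_order all_algebra.
From mathcomp Require Import constructive_ereal.

Set Implicit Arguments.
Unset Strict Implicit.
Unset Printing Implicit Defensive.

Import Order.TTheory GRing.Theory Num.Theory.

Local Open Scope nat_scope.

(* [Bprefix k j n] lists B_{n-1}(k,j), ..., B_0(k,j), latest value first. *)
Fixpoint Bprefix (k j n : nat) : seq nat :=
  if n is m.+1 then
    let s := Bprefix k j m in
    (if m < k then nat_of_bool (m == j) else sumn (take k s)) :: s
  else [::].

(* B_n(k,j); it is characterised by [B_init] and [B_rec] below. *)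
Definition B (k j n : nat) : nat := head 0 (Bprefix k j n.+1).

Lemma B_init k j n : n < k -> B k j n = (n == j).
Proof. by move=> nk; rewrite /B /= nk. Qed.

Lemma size_Bprefix k j n : size (Bprefix k j n) = n.
Proof. by elim: n => //= n ->. Qed.

Lemma nth_Bprefix k j n i : i < n -> nth 0 (Bprefix k j n) i = B k j (n - i.+1).
Proof.
elim: n i => [//|n IHn] [|i] lt_i_n; first by rewrite subn1.
by rewrite [LHS]/= IHn ?subSS.
Qed.

Lemma B_rec k j n : k <= n -> B k j n = \sum_(1 <= i < k.+1) B k j (n - i).
Proof.
move=> kn; rewrite [LHS]/B /= ltnNge kn /= sumnE.
rewrite (big_nth 0) size_takel ?size_Bprefix // big_add1.
rewrite !big_nat; apply: eq_bigr => i /andP[_ ik].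
by rewrite nth_take // nth_Bprefix // (leq_trans ik).
Qed.

(* 2-adic valuation; unlike [logn 2], it takes the value +oo at 0. *)
Definition v2 (m : nat) : \bar int :=
  if m == 0 then +oo%E else ((logn 2 m)%:Z)%:E.

(* The binomial coefficients and powers of 2 below have integer arguments
   which are nonnegative in the ranges where each quantity is used
   (-1 <= r < j and 2 <= a for [Delta1] and [Delta2], j <= r < k and 1 <= a
   for [Delta3] and [Delta4]); there [`|_|%N] is the identity. *)
Definition Delta1 (k : nat) (a r : int) : \bar int :=
  ((r + k%:Z + 2)%R%:E
   - v2 ('C(`|(a + r)%R|, `|(a - 1)%R|) * 2 ^ `|(r + 1)%R|))%E.

Definition Delta2 (k j : nat) (a r : int) : \bar int :=
  (v2 ('C(`|(a + r + k%:Z - j%:Z - 1)%R|, `|(a - 2)%R|)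
       * 2 ^ `|(r + k%:Z + 1 - j%:Z)%R|)
   - v2 ('C(`|(a + r)%R|, `|(a - 1)%R|) * 2 ^ `|(r + 1)%R|))%E.

Definition Delta3 (k j : nat) (a r : int) : \bar int :=
  ((r + k%:Z + 1 - j%:Z)%R%:E
   - v2 ('C(`|(a + r - j%:Z - 1)%R|, `|(a - 1)%R|) * 2 ^ `|(r - j%:Z)%R|))%E.

Definition Delta4 (j : nat) (a r : int) : \bar int :=
  (v2 ('C(`|(a + r)%R|, `|(a - 1)%R|) * 2 ^ `|(r + 1)%R|)
   - v2 ('C(`|(a + r - j%:Z - 1)%R|, `|(a - 1)%R|) * 2 ^ `|(r - j%:Z)%R|))%E.

(* Main.v *)
Require Import Defs.
From mathcomp Require Import all_boot all_order all_algebra.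
From mathcomp Require Import constructive_ereal.
From mathcomp Require Import zify ring.

Set Implicit Arguments.
Unset Strict Implicit.
Unset Printing Implicit Defensive.

Import Order.TTheory GRing.Theory Num.Theory.

Local Open Scope ring_scope.

(** Let G_m be the coefficients of 1 / (1 - 2x + x^(k+1)).  The generating
    function of B_n(k,j) is (x^j - 2x^(j+1) + x^k) / (1 - 2x + x^(k+1)), whence
    B_(k+m) = G_m - G_(m-j-1), with G_i = 0 for i < 0.  Pascal's rule and
    G_(m+k+1) = 2 G_(m+k) - G_m give, for 0 <= s <= k, the congruence
    G_(a(k+1)+s) = (-1)^a 'C(a+s, a) 2^s modulo 2^(s+k+1).  The hypotheses on
    the Delta's say that one of the two leading terms of G_m - G_(m-j-1) has
    smaller 2-adic valuation than everything else. *)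

(* 1 / (1 - 2x + x^(k+1)) = (1 - x)^-1 (1 - x - ... - x^k)^-1, so G is the
   sequence of partial sums of the shifted k-bonacci numbers. *)
Definition G (k m : nat) : nat := (\sum_(i < m.+1) B k k.-1 (i + k.-1))%N.

(** The windows of [k] terms summed for [n.+1] and [n] differ by one term entering and one
    leaving. *)
Lemma B_double k j n :
  (0 < k)%N -> (k <= n)%N -> (B k j n.+1 + B k j (n - k) = (B k j n).*2)%N.
Proof.
case: k => // k _ kn; rewrite -addnn {2}(B_rec _ kn) (B_rec _ (leqW kn)).
rewrite big_nat_recl // subn1 /= [in RHS]big_nat_recr //= -addnA.
by congr (_ + (_ + _))%N.
Qed.

Lemma B_k k j : (j < k)%N -> B k j k = 1%N.
Proof.
move=> jk; rewrite B_rec // big_nat_rev /= big_add1 /= big_mkord.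
rewrite (bigD1 (Ordinal jk)) //= big1 => [|i /negPf ij].
  rewrite B_init; last by lia.
  have -> : (k - (1 + k.+1 - j.+2) = j)%N by lia.
  by rewrite eqxx.
rewrite B_init; last by have := ltn_ord i; lia.
have -> : (k - (1 + k.+1 - i.+2) = i)%N by have := ltn_ord i; lia.
by rewrite -val_eqE /= in ij; rewrite ij.
Qed.

Lemma G0 k : (0 < k)%N -> G k 0 = 1%N.
Proof. by case: k => // k _; rewrite /G big_ord1 B_init ?eqxx. Qed.

(** The recurrence carried by the denominator 1 - 2x + x^(k+1), obtained by summing [B_double];
    [else 0] encodes G_i = 0 for i < 0. *)
Lemma G_double k m :
  (0 < k)%N -> (G k m.+1 + (if k <= m then G k (m - k) else 0) = (G k m).*2)%N.
Proof.
case: k => // k _; elim: m => [|m IHm].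
  rewrite /G !big_ord_recr big_ord0 /= add1n B_k // B_init // eqxx; lia.
have GS i : G k.+1 i.+1 = (G k.+1 i + B k.+1 k (i.+1 + k))%N.
  by rewrite /G big_ord_recr.
rewrite GS in IHm; have := @B_double k.+1 k (m.+1 + k) isT; rewrite -addSn !GS.
have -> : (m.+1 + k - k.+1 = m)%N by lia.
(* The lagged term [B k.+1 k m] is the increment of the lagged [G]: a difference of two values for m
   > k, 0 for m < k, and G_0 = 1 for m = k. *)
move=> /(_ ltac:(lia)); case: ltngtP IHm => [mk|km|<-].
- have := GS (m - k.+1)%N; rewrite ltnS (ltnW mk) subSS subnSK // subnK 1?ltnW //.
  lia.
- by rewrite ltnS leqNgt km (@B_init _ _ m) /= ?ltn_eqF; lia.
by rewrite ltnSn subnn G0 // (@B_init _ _ k) // eqxx; lia.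
Qed.

Lemma B_G k j m : (j < k)%N ->
  (B k j (k + m) + (if j < m then G k (m - j.+1) else 0) = G k m)%N.
Proof.
move=> jk; have k0 : (0 < k)%N by case: k jk.
elim/ltn_ind: m => -[_|m IHm]; first by rewrite addn0 B_k // G0.
have Bd := @B_double k j (k + m) k0 (leq_addr _ _).
rewrite addnS; rewrite addKn in Bd.
have IH := IHm m (ltnSn m); have Gd := G_double m k0.
(* The induction hypothesis covers this lagged term if k <= m. Otherwise it is an initial value, and
   the single 1, at m = j, matches G_0 = 1 starting the shifted copy of [G]. *)
have Bm : (B k j m = if k <= m then B k j (k + (m - k)) else m == j)%N.
  by case: leqP => [/subnKC->|/B_init].
rewrite {}Bm in Bd.
case: (leqP k m) Bd Gd => [km|mk] Bd Gd.
- have IHk := IHm (m - k)%N ltac:(lia).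
  have Gj := G_double (m - j.+1) k0.
  have jm : (j < m)%N by lia.
  rewrite ltnS (ltnW jm) subSS -subnSK //; rewrite jm in IH.
  have jmk : (j < m - k)%N = (k <= m - j.+1)%N by lia.
  rewrite jmk in IHk.
  have E : (m - k - j.+1 = m - j.+1 - k)%N by lia.
  by rewrite E in IHk; case: ifP IHk Gj; lia.
- rewrite ltnS subSS; case: (ltngtP j m) IH Bd Gd => [jm|mj|<-] IH Bd Gd.
  + have Gj := G_double (m - j.+1) k0.
    rewrite ifN in Gj; last by lia.
    by rewrite -subnSK //; lia.
  + lia.
  + by rewrite subnn G0 //; lia.
Qed.

Lemma G_mod k a s : (0 < k)%N -> (s <= k)%N ->
  exists c : int, (G k (a * k.+1 + s))%:Z
    = (-1) ^+ a * 'C(a + s, a)%:Z * 2 ^+ s + 2 ^+ (s + k.+1) * c.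
Proof.
move=> k0; elim: a s => [|a IHa] s sk.
  exists 0; rewrite mul0n !add0n bin0 mulr0 addr0 !mul1r.
  elim: s sk => [|s IHs] sk; first by rewrite G0.
  by have := G_double s k0; rewrite leqNgt sk exprS -IHs 1?ltnW //=; lia.
have Gd i : (G k (a.+1 * k.+1 + i).+1)%:Z
    = 2 * (G k (a.+1 * k.+1 + i))%:Z - (G k (a * k.+1 + i.+1))%:Z.
  have := G_double (a.+1 * k.+1 + i) k0; rewrite ifT; last by lia.
  have -> : (a.+1 * k.+1 + i - k = a * k.+1 + i.+1)%N by lia.
  lia.
elim: s sk => [|s IHs] sk.
  (* The predecessor of s = 0 is s = k in the previous block. Doubling makes that value a multiple
     of 2^(k+1), the modulus here, so only -G_(a(k+1)) counts. *)
  have [c Gk] := IHa k (leqnn k); have [d G0'] := IHa 0%N (leq0n k).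
  have := G_double (a * k.+1 + k) k0; rewrite leq_addl addnK.
  have -> : ((a * k.+1 + k).+1 = a.+1 * k.+1 + 0)%N by lia.
  move=> Gd'.
  exists ((-1) ^+ a * 'C(a + k, a)%:Z + 2 ^+ k.+1 * c - d).
  have -> : (G k (a.+1 * k.+1 + 0))%:Z
      = 2 * (G k (a * k.+1 + k))%:Z - (G k (a * k.+1 + 0))%:Z.
    by rewrite !addn0 in Gd' *; lia.
  rewrite Gk G0' !addn0 !binn !add0n !exprD !exprS expr0; ring.
have [c Gs] := IHs (ltnW sk); have [d Gt] := IHa s.+1 sk.
(* Doubling lifts the error of the first term to modulus 2^(s+k+2), which the second already has. *)
exists (c - d); rewrite addnS Gd Gs Gt.
have -> : 'C(a.+1 + s.+1, a.+1) = ('C(a.+1 + s, a.+1) + 'C(a + s.+1, a))%N.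
  by rewrite addnS binS addSnnS.
rewrite PoszD addSn !exprS; ring.
Qed.

Lemma Posz_exp2 n : (2 ^ n)%N%:Z = 2 ^+ n.
Proof. by rewrite -natrX natz. Qed.

(** Dividing by the exact power of 2 in [T] leaves an odd number plus an even one. *)
Lemma v2_mod (b T e : nat) (c : int) : (0 < T)%N ->
  b%:Z = (-1) ^+ e * T%:Z + 2 ^+ (logn 2 T).+1 * c -> v2 b = v2 T.
Proof.
move=> T0; have [u cu TE] := pfactor_coprime (isT : prime 2) T0.
have ou : odd u by rewrite -coprime2n.
rewrite {1}TE => bE.
set w := absz ((-1) ^+ e * u%:Z + 2 * c).
have ow : odd w.
  rewrite /w -signr_odd; case: (odd e); rewrite ?expr0 ?expr1; lia.
have {}bE : b = (w * 2 ^ logn 2 T)%N.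
  have -> : w = absz ((-1) ^+ e * u%:Z + 2 * c) by [].
  rewrite -[b]absz_nat bE -[(2 ^ _)%N]absz_nat -abszM; congr absz.
  rewrite absz_nat !PoszM exprS !Posz_exp2; ring.
have w0 : (0 < w)%N by case: (w) ow.
have b0 : (0 < b)%N by rewrite bE muln_gt0 w0 expn_gt0.
rewrite /v2 !gtn_eqF // bE lognM ?expn_gt0 // pfactorK // logn_coprime //.
by rewrite coprime2n.
Qed.

Lemma v2M_pow2 (m s : nat) : (v2 (m * 2 ^ s) = v2 m + (s%:Z)%:E)%E.
Proof.
rewrite /v2 muln_eq0 expn_eq0 /= orbF; case: eqP => [_//|/eqP m0].
by rewrite lognM ?lt0n ?expn_eq0 // pfactorK // -EFinD PoszD.
Qed.

Lemma v2_pos (m : nat) : (0 < m)%N -> v2 m = ((logn 2 m)%:Z)%:E.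
Proof. by rewrite /v2 lt0n => /negPf->. Qed.

Lemma exp2_split (e l : nat) : (l < e)%N ->
  exists d : int, (2 ^+ e : int) = 2 ^+ l.+1 * d.
Proof.
by move=> le; exists (2 ^+ (e - l.+1)); rewrite -exprD subnKC.
Qed.

Lemma logn2_split (m l : nat) : (l < logn 2 m)%N ->
  exists d : int, m%:Z = 2 ^+ l.+1 * d.
Proof.
move=> lm; have /dvdnP[d ->] : (2 ^ l.+1 %| m)%N.
  by case: m lm => [|m] lm; rewrite ?dvdn0 // pfactor_dvdn.
by exists d; rewrite PoszM mulrC Posz_exp2.
Qed.

(** With n = k + m, the theorem's r becomes s = r + 1, and [a] is two less than there. As s <= j,
    the index m - j - 1 lies in the previous block, at s + k - j. *)
Lemma v2_B_low k j a s (T := ('C(a.+1 + s, a.+1) * 2 ^ s)%N)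
    (U := ('C(a + (s + k - j), a) * 2 ^ (s + k - j))%N) :
  (j < k)%N -> (s <= j)%N ->
  (logn 2 T < s + k.+1)%N -> (logn 2 T < logn 2 U)%N ->
  v2 (B k j (k + (a.+1 * k.+1 + s))) = v2 T.
Proof.
move=> jk sj lT lU; have k0 : (0 < k)%N by case: k jk {lT lU U}.
have [c Gc] := @G_mod k a.+1 s k0 ltac:(lia).
have [d Gd] := @G_mod k a (s + k - j) k0 ltac:(lia).
have BG := B_G (a.+1 * k.+1 + s) jk.
rewrite ifT in BG; last by lia.
have E : (a.+1 * k.+1 + s - j.+1 = a * k.+1 + (s + k - j))%N by lia.
rewrite {}E in BG.
have [x Ex] := exp2_split lT.
have [y Ey] := logn2_split lU.
have [z Ez] : exists z : int, (2 ^+ (s + k - j + k.+1) : int) 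
    = 2 ^+ (logn 2 T).+1 * z.
  by apply: exp2_split; lia.
apply: (@v2_mod _ _ a.+1 (x * c - (-1) ^+ a * y - z * d)).
  by rewrite muln_gt0 bin_gt0 expn_gt0 leq_addr.
have -> : (B k j (k + (a.+1 * k.+1 + s)))%:Z
   = (G k (a.+1 * k.+1 + s))%:Z - (G k (a * k.+1 + (s + k - j)))%:Z by lia.
rewrite Gc Gd Ex Ez.
have TE : T%:Z = 'C(a.+1 + s, a.+1)%:Z * 2 ^+ s by rewrite PoszM Posz_exp2.
have UE : U%:Z = 'C(a + (s + k - j), a)%:Z * 2 ^+ (s + k - j).
  by rewrite PoszM Posz_exp2.
rewrite -[X in X + _ - _]mulrA -[X in _ - (X + _)]mulrA -TE -UE Ey; ring.
Qed.

(** Here m - j - 1 stays in the block of m, at q = r - j, and the subtracted term dominates; [a] is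
    one less than in the theorem. *)
Lemma v2_B_high k j a q (T := ('C(a + (q + j.+1), a) * 2 ^ (q + j.+1))%N)
    (V := ('C(a + q, a) * 2 ^ q)%N) :
  (q + j < k)%N ->
  (logn 2 V < q + k.+1)%N -> (logn 2 V < logn 2 T)%N ->
  v2 (B k j (k + (a * k.+1 + (q + j.+1)))) = v2 V.
Proof.
move=> qjk lV lT; have k0 : (0 < k)%N by lia.
have [c Gc] := @G_mod k a (q + j.+1) k0 ltac:(lia).
have [d Gd] := @G_mod k a q k0 ltac:(lia).
have BG := @B_G k j (a * k.+1 + (q + j.+1)) ltac:(lia).
rewrite ifT in BG; last by lia.
have E : (a * k.+1 + (q + j.+1) - j.+1 = a * k.+1 + q)%N by lia.
rewrite {}E in BG.
have [x Ex] := exp2_split lV.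
have [y Ey] := logn2_split lT.
have [z Ez] : exists z : int, (2 ^+ (q + j.+1 + k.+1) : int) 
    = 2 ^+ (logn 2 V).+1 * z.
  by apply: exp2_split; lia.
apply: (@v2_mod _ _ a.+1 ((-1) ^+ a * y + z * c - x * d)).
  by rewrite muln_gt0 bin_gt0 expn_gt0 leq_addr.
have -> : (B k j (k + (a * k.+1 + (q + j.+1))))%:Z
   = (G k (a * k.+1 + (q + j.+1)))%:Z - (G k (a * k.+1 + q))%:Z by lia.
rewrite Gc Gd Ex Ez.
have VE : V%:Z = 'C(a + q, a)%:Z * 2 ^+ q by rewrite PoszM Posz_exp2.
have TE : T%:Z = 'C(a + (q + j.+1), a)%:Z * 2 ^+ (q + j.+1).
  by rewrite PoszM Posz_exp2.
rewrite -[X in X + _ - _]mulrA -[X in _ - (X + _)]mulrA -VE -TE Ey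
  [(-1) ^+ a.+1]exprS; ring.
Qed.

Theorem theorem6 (k j n : nat) (a r : int)
    (hk : (2 <= k)%N) (hj : (j < k)%N)
    (hr : -1 <= r <= k%:Z - 1)
    (hn : n%:Z = a * (k%:Z + 1) + r) :
  [/\ r = -1 \/ r = j%:Z -> v2 (B k j n) = 0%E,
      0 <= r <= j%:Z - 1 -> 2 <= a ->
      (0 < Delta1 k a r)%E -> (0 < Delta2 k j a r)%E ->
      v2 (B k j n) = ((r + 1)%:E + v2 'C(`|(a + r)%R|, `|(a - 1)%R|))%E
    & j%:Z + 1 <= r <= k%:Z - 1 -> 1 <= a ->
      (0 < Delta3 k j a r)%E -> (0 < Delta4 j a r)%E ->
      v2 (B k j n)
        = ((r - j%:Z)%:E + v2 'C(`|(a + r - j%:Z - 1)%R|, `|(a - 1)%R|))%E].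
Proof.
have a0 : 0 <= a by nia.
case: a a0 hn => // a _ hn; split.
- case=> rE; subst r.
    (* For r = -1, a = 0 contradicts n >= 0 and a = 1 gives n = k; beyond that, s = 0 and the main
       term is 1. *)
    case: a hn => [|[|a]] hn; first by lia.
      have -> : n = k by lia.
      by rewrite B_k.
    have -> : n = (k + (a.+1 * k.+1 + 0))%N by lia.
    rewrite v2_B_low ?addn0 ?binn ?muln1 ?logn1 //.
    by rewrite lognM ?bin_gt0 ?leq_addr ?expn_gt0 // pfactorK // add0n; lia.
  case: a hn => [|a] hn.
    have -> : n = j by lia.
    by rewrite B_init // eqxx.
  have -> : n = (k + (a * k.+1 + (0 + j.+1)))%N by lia.
  rewrite v2_B_high ?addn0 ?binn ?muln1 ?logn1 //.
  by rewrite lognM ?bin_gt0 ?leq_addr ?expn_gt0 // pfactorK // add0n addnS.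
- case: r hr hn => // s _ hn sj; case: a hn => [|[|a]] // hn _.
  rewrite /Delta1 /Delta2.
  have -> : `|(a.+2%:Z + s)%R|%N = (a.+1 + s.+1)%N by lia.
  have -> : `|(a.+2%:Z - 1)%R|%N = a.+1 by lia.
  have -> : `|(a.+2%:Z - 2)%R|%N = a by lia.
  have -> : `|(s%:Z + 1)%R|%N = s.+1 by lia.
  have -> : `|(a.+2%:Z + s + k%:Z - j%:Z - 1)%R|%N = (a + (s.+1 + k - j))%N by lia.
  have -> : `|(s%:Z + k%:Z + 1 - j%:Z)%R|%N = (s.+1 + k - j)%N by lia.
  have -> : n = (k + (a.+1 * k.+1 + s.+1))%N by lia.
  (* The binomials are positive, so the valuations are finite and the Delta conditions become the
     integer inequalities of [v2_B_low]. *)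
  rewrite !(v2_pos (m := (_ * _)%N)) ?muln_gt0 ?bin_gt0 ?leq_addr ?expn_gt0 //.
  rewrite -!EFinB !lte_fin => D1 D2.
  rewrite v2_B_low //; [|lia..].
  by rewrite v2M_pow2 addeC; congr (_%:E + _)%E; lia.
- case: r hr hn => // s _ hn sj; case: a hn => [|a] // hn _.
  rewrite /Delta3 /Delta4.
  have [q sE] : exists q, (s = q + j)%N by exists (s - j)%N; lia.
  subst s.
  have -> : `|(a.+1%:Z + (q + j)%N)%R|%N = (a + (q + j.+1))%N by lia.
  have -> : `|(a.+1%:Z - 1)%R|%N = a by lia.
  have -> : `|((q + j)%N%:Z + 1)%R|%N = (q + j.+1)%N by lia.
  have -> : `|(a.+1%:Z + (q + j)%N - j%:Z - 1)%R|%N = (a + q)%N by lia.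
  have -> : `|((q + j)%N%:Z - j%:Z)%R|%N = q by lia.
  have -> : n = (k + (a * k.+1 + (q + j.+1)))%N by lia.
  rewrite !(v2_pos (m := (_ * _)%N)) ?muln_gt0 ?bin_gt0 ?leq_addr ?expn_gt0 //.
  rewrite -!EFinB !lte_fin => D3 D4.
  rewrite v2_B_high //; [|lia..].
  by rewrite v2M_pow2 addeC; congr (_%:E + _)%E; lia.
Qed.
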